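(* Let $n\ge1$. If $H$ is dense in $\widehat{\mathcal F_n}$, then the Kripke model $\mathfrak K_n=(K_n,\le,\mathrm{val})$ is (first-order) interpretable in $H$ with parameters $a_1,\dots,a_n$, where $a_1,\dots,a_n$ are the pre-generators.
   Context: Fix $n\ge1$ and symbols $P_1,\dots,P_n$. The generic Kripke model $\mathfrak K_n=(K_n,\le,\mathrm{val})$ consists of a partially ordered set $(K_n,\le)$ and a valuation map $\mathrm{val}:K_n\to\mathfrak P(\{P_1,\dots,P_n\})$; it is the increasing union of finite pieces $K_n^d$ ($d\ge 0$) built recursively: $K_n^{-1}=\emptyset$, and $K_n^d\setminus K_n^{d-1}$ consists of exactly one point $w_{\beta,Y}$ for each pair $(\beta,Y)$ such that (i) $Y$ is a decreasing subset of $K_n^{d-1}$ with $Y\not\subseteq K_n^{d-2}$ (for $d=0$ this last condition is void, so $Y=\emptyset$); (ii) $\beta\subseteq\{P_1,\dots,P_n\}$ and $\beta\subseteq\mathrm{val}(w')$ for all $w'\in Y$; (iii) if $Y$ is the decreasing set generated by a single element $w_{\beta',Y'}$, then $\beta\ne\beta'$. One sets $\mathrm{val}(w_{\beta,Y})=\beta$, and $w\le w_{\beta,Y}$ iff $w\in Y$ or $w=w_{\beta,Y}$. As a first-order structure, $\mathfrak K_n$ is the set $K_n$ with the binary relation $\le$ and, for each $I\subseteq\{1,\dots,n\}$, the unary relation ''$\mathrm{val}(x)=\{P_i: i\in I\}$''. $\widehat{\mathcal F_n}:=\mathcal O_\downarrow(K_n,\le)$ is the Heyting algebra of all decreasing subsets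 of $K_n$ ($\sqcap=\cap$, $\sqcup=\cup$, $a\to b$ = the largest decreasing set contained in $(K_n\setminus a)\cup b$), considered in the language $\mathcal L_{HA}=\{0,1,\sqcap,\sqcup,\to\}$. It carries the metric $\mathrm d(a,b)=2^{-\min\{i\in\mathbb N\mid a\cap K_n^i\neq b\cap K_n^i\}}$ ($2^{-\min\emptyset}=0$). ''$H$ is dense in $\widehat{\mathcal F_n}$'' means that $H$ is a Heyting sub-algebra of $\widehat{\mathcal F_n}$ that is dense for this metric; such an $H$ contains all finite decreasing subsets of $K_n$. The pre-generators are the atoms $a_i=\{w_{\{P_i\},\emptyset}\}$, $i=1,\dots,n$. *)

(* Defs.v *)
From HB Require Import structures.
From mathcomp Require Import all_boot all_order all_algebra finmap.
From mathcomp Require Import all_classical reals Rstruct.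
From mathcomp Require Import topology_structure uniform_structure.
From mathcomp Require Import pseudometric_structure metric_structure.

Set Implicit Arguments.
Unset Strict Implicit.
Unset Printing Implicit Defensive.

Import Order.TTheory GRing.Theory Num.Theory.

Local Open Scope classical_set_scope.

Record signature := Signature {
  fsym : Type; far : fsym -> nat;
  rsym : Type; rar : rsym -> nat }.

(* Variables are the elements of an arbitrary type [X]; a quantifier binds the
   variable [None] of a formula over [option X].  A formula over a finite type
   [X] is thus a formula whose free variables are among the elements of [X]. *)
Inductive term (L : signature) (X : Type) : Type :=
| Var of X
| App (f : fsym L) of ('I_(far f) -> term L X).

Inductive formula (L : signature) (X : Type) : Type :=
| FFalse
| FEq of term L X & term L X
| FRel (r : rsym L) of ('I_(rar r) -> term L X)
| FAnd of formula L X & formula L X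
| FOr of formula L X & formula L X
| FImp of formula L X & formula L X
| FAll of formula L (option X)
| FEx of formula L (option X).

Record structure (L : signature) := Structure {
  carrier :> Type;
  fint : forall f : fsym L, ('I_(far f) -> carrier) -> carrier;
  rint : forall r : rsym L, ('I_(rar r) -> carrier) -> Prop }.

Section Semantics.
Context (L : signature) (M : structure L).

Fixpoint eval (X : Type) (v : X -> M) (t : term L X) : M :=
  match t with
  | Var x => v x
  | App f ts => fint (fun i => eval v (ts i))
  end.

Definition extend (X : Type) (v : X -> M) (m : M) (x : option X) : M :=
  if x is Some y then v y else m.

Fixpoint sat (X : Type) (phi : formula L X) : (X -> M) -> Prop :=
  match phi with
  | FFalse => fun _ => False
  | FEq s t => fun v => eval v s = eval v t
  | FRel r ts => fun v => rint (fun i => eval v (ts i))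
  | FAnd a b => fun v => sat a v /\ sat b v
  | FOr a b => fun v => sat a v \/ sat b v
  | FImp a b => fun v => sat a v -> sat b v
  | FAll a => fun v => forall m : M, sat a (extend v m)
  | FEx a => fun v => exists m : M, sat a (extend v m)
  end.

Definition closed_under_functions (A : set M) : Prop :=
  forall (f : fsym L) (ms : 'I_(far f) -> M),
    (forall i, A (ms i)) -> A (fint ms).

Lemma fint_sub (A : set M) (hA : closed_under_functions A) (f : fsym L)
  (ms : 'I_(far f) -> A) : fint (fun i => val (ms i)) \in A.
Proof. by apply/mem_set/hA => i; apply/set_mem/valP. Qed.

Definition substructure (A : set M) (hA : closed_under_functions A) :
  structure L :=
  @Structure L A
    (fun f ms => exist _ (fint (fun i => val (ms i))) (fint_sub hA ms))
    (fun r ms => rint (fun i => val (ms i))).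

End Semantics.

(* The variable [inl (j, k)] stands for the [k]-th component of the [j]-th
   tuple of the family [a], the variable [inr q] for the parameter [p q]. *)
Definition valuation (N J K Q : Type) (a : J -> K -> N) (p : Q -> N)
  (x : J * K + Q) : N :=
  match x with inl (j, k) => a j k | inr q => p q end.

Definition tuples_sat (L : signature) (N : structure L) (Q : Type) (p : Q -> N)
  (k : nat) (phi : formula L (unit * 'I_k + Q)) : Type :=
  {t : 'I_k -> N | sat phi (valuation (fun _ => t) p)}.

(* Elements of [M] are represented by the tuples satisfying [idom].  Equality,
   the relations and the graphs of the functions of [M] (where the index [None]
   stands for the value) pull back to relations defined in [N] by formulas with
   parameters among the [p q]. *)
Record interpretation (L L' : signature) (M : structure L) (N : structure L')
  (Q : Type) (p : Q -> N) := Interpretation {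
  idim : nat;
  idim_gt0 : (0 < idim)%N;
  idom : formula L' (unit * 'I_idim + Q);
  ieq : formula L' ('I_2 * 'I_idim + Q);
  irel : forall r : rsym L, formula L' ('I_(rar r) * 'I_idim + Q);
  igraph : forall f : fsym L, formula L' (option 'I_(far f) * 'I_idim + Q);
  imap : tuples_sat p idom -> M;
  imap_surj : forall m : M, exists t, imap t = m;
  ieqP : forall t : 'I_2 -> tuples_sat p idom,
    sat ieq (valuation (fun j => sval (t j)) p) <->
    imap (t ord0) = imap (t ord_max);
  irelP : forall (r : rsym L) (t : 'I_(rar r) -> tuples_sat p idom),
    sat (irel r) (valuation (fun j => sval (t j)) p) <->
    rint (fun j => imap (t j));
  igraphP : forall (f : fsym L) (t : option 'I_(far f) -> tuples_sat p idom),
    sat (igraph f) (valuation (fun j => sval (t j)) p) <->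
    fint (fun j => imap (t (Some j))) = imap (t None) }.

Definition interpretable (L L' : signature) (M : structure L)
  (N : structure L') (Q : Type) (p : Q -> N) : Prop :=
  inhabited (interpretation M p).

(* The point w_(b, Y) is coded by a natural number, so that finite sets of
   points are elements of [{fset nat}]; on numbers that are not codes,
   [kdecode] takes a dummy value. *)
Definition kpt n (b : {set 'I_n}) (Y : {fset nat}) : nat := choice.pickle (b, Y).

Definition kdecode n (w : nat) : {set 'I_n} * {fset nat} :=
  odflt (finset.set0, fset0) (choice.unpickle w).
Definition kval n (w : nat) : {set 'I_n} := (kdecode n w).1.
Definition kbelow n (w : nat) : {fset nat} := (kdecode n w).2.
Definition kle n (v w : nat) : bool := (v \in kbelow n w) || (v == w).

Lemma kptK n (b : {set 'I_n}) Y : kdecode n (kpt b Y) = (b, Y).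
Proof. by rewrite /kdecode /kpt choice.pickleK. Qed.

(* The set [A] is K_n^{d-1} for some [d]; the last condition is the one on
   principal [Y]. *)
Definition kadmissible n (A : {fset nat}) (b : {set 'I_n}) (Y : {fset nat}) :
  Prop :=
  [/\ (Y `<=` A)%fset,
      forall v w, w \in Y -> v \in A -> kle n v w -> v \in Y,
      forall w, w \in Y -> b \subset kval n w &
      forall w, w \in A -> Y = [fset v in A | kle n v w]%fset ->
        b <> kval n w].

(* The points w_(b, Y) with [Y] an admissible subset of [A] satisfying [P]. *)
Definition klayer n (A : {fset nat}) (P : pred {fset nat}) : {fset nat} :=
  [fset kpt x.1 x.2 |
    x in [seq (b, Y) | b <- enum {: {set 'I_n}}, Y <- fpowerset A] &
    P x.2 && `[< kadmissible A x.1 x.2 >]]%fset.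

Lemma klayerP n A P w :
  w \in klayer n A P <->
  exists (b : {set 'I_n}) Y, [/\ P Y, kadmissible A b Y & w = kpt b Y].
Proof.
split=> [/imfsetP[[b Y] /=]|[b [Y [PY bY ->]]]].
  by rewrite inE /= => /andP[_ /andP[PY /asboolP bY]] ->; exists b, Y.
apply/imfsetP; exists (b, Y) => //=; rewrite inE /= PY; apply/andP; split.
  apply: allpairs_f; first by rewrite mem_enum.
  by rewrite fpowersetE; case: bY.
exact/asboolP.
Qed.

(* [kprev n d] is K_n^{d-1}. *)
Fixpoint kprev (n d : nat) : {fset nat} :=
  match d with
  | 0 => fset0
  | e.+1 =>
      kprev n e `|` klayer n (kprev n e)
        (if e is e'.+1 then fun Y => ~~ (Y `<=` kprev n e')%fset else xpredT)
  end%fset.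

Definition kstage (n d : nat) : {fset nat} := kprev n d.+1.

Definition K (n : nat) : Type := [set w : nat | exists d, w \in kstage n d].

Inductive kripke_rel (n : nat) := KLe | KVal of {set 'I_n}.

Definition kripke_ar n (r : kripke_rel n) : nat := if r is KLe then 2 else 1.

Definition kripke_sig (n : nat) : signature :=
  @Signature void (fun=> 0%N) (kripke_rel n) (@kripke_ar n).

Definition kripke_model (n : nat) : structure (kripke_sig n) :=
  @Structure (kripke_sig n) (K n)
    (fun f : void => match f with end)
    (fun r => match r return ('I_(kripke_ar r) -> K n) -> Prop with
      | KLe => fun w => kle n (val (w ord0)) (val (w ord_max))
      | KVal J => fun w => kval n (val (w ord0)) = J
      end).

Definition decreasing n (a : set (K n)) : Prop :=
  forall v w : K n, kle n (val v) (val w) -> a w -> a v.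

Definition Fhat (n : nat) : Type := [set a : set (K n) | decreasing a].

HB.instance Definition _ (n : nat) := Choice.on (Fhat n).

Definition mkFhat n (a : set (K n)) (ha : decreasing a) : Fhat n :=
  exist _ a (mem_set ha).

Section Operations.
Variable n : nat.
Implicit Types a b : Fhat n.

Lemma FhatP a : decreasing (val a).
Proof. exact: set_mem (valP a). Qed.

Lemma Fhat_bot_subproof : decreasing (set0 : set (K n)).
Proof. by []. Qed.
Definition Fhat_bot := mkFhat Fhat_bot_subproof.

Lemma Fhat_top_subproof : decreasing (setT : set (K n)).
Proof. by []. Qed.
Definition Fhat_top := mkFhat Fhat_top_subproof.

Lemma Fhat_meet_subproof a b : decreasing (val a `&` val b).
Proof. by move=> v w vw [aw bw]; split; exact: FhatP vw _. Qed.
Definition Fhat_meet a b := mkFhat (@Fhat_meet_subproof a b).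

Lemma Fhat_join_subproof a b : decreasing (val a `|` val b).
Proof. by move=> v w vw [aw|bw]; [left|right]; exact: FhatP vw _. Qed.
Definition Fhat_join a b := mkFhat (@Fhat_join_subproof a b).

(* The union of the decreasing sets contained in ~` a `|` b is itself
   contained in it, hence it is the largest one. *)
Lemma Fhat_imp_subproof a b :
  decreasing (\bigcup_(c in [set c | decreasing c /\ c `<=` ~` val a `|` val b])
                c).
Proof. by move=> v w vw [c [dc cab] cw]; exists c => //; exact: dc vw cw. Qed.
Definition Fhat_imp a b := mkFhat (@Fhat_imp_subproof a b).

End Operations.

Inductive ha_op := Bot | Top | Meet | Join | Imp.

Definition ha_ar (o : ha_op) : nat :=
  match o with Bot | Top => 0 | Meet | Join | Imp => 2 end.

Definition ha_sig : signature := @Signature ha_op ha_ar void (fun=> 0%N).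

Definition Fhat_ha (n : nat) : structure ha_sig :=
  @Structure ha_sig (Fhat n)
    (fun o => match o return ('I_(ha_ar o) -> Fhat n) -> Fhat n with
      | Bot => fun=> Fhat_bot n
      | Top => fun=> Fhat_top n
      | Meet => fun a => Fhat_meet (a ord0) (a ord_max)
      | Join => fun a => Fhat_join (a ord0) (a ord_max)
      | Imp => fun a => Fhat_imp (a ord0) (a ord_max)
      end)
    (fun r : void => match r with end).

Definition heyting_subalgebra (n : nat) (H : set (Fhat n)) : Prop :=
  closed_under_functions (H : set (Fhat_ha n)).

Section Metric.
Variable n : nat.
Implicit Types a b c : Fhat n.
Local Open Scope ring_scope.

Definition trunc (a : Fhat n) (i : nat) : set (K n) :=
  val a `&` [set w | val w \in kstage n i].

Definition differ a b (i : nat) : bool := `[< trunc a i <> trunc b i >].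

Definition Fhat_dist a b : Rdefinitions.R :=
  match pselect (exists i, differ a b i) with
  | left h => 2^-1 ^+ ex_minn h
  | right _ => 0
  end.

Lemma Fhat_dist_le a b m :
  Fhat_dist a b <= 2^-1 ^+ m <-> forall i, (i < m)%N -> trunc a i = trunc b i.
Proof.
have half01 : 0 < (2^-1 : Rdefinitions.R) < 1.
  by rewrite invr_gt0 ltr0n invf_lt1 ?ltr0n // ltr1n.
case/andP: half01 => h0 h1; rewrite /Fhat_dist; case: pselect => [h|noi].
  case: ex_minnP => k /asboolP dk kmin; rewrite ler_iXn2l //.
  split=> [mk i im|abm].
    apply: contrapT => di; have ki : (k <= i)%N by apply/kmin/asboolP.
    by move: (ki); rewrite leqNgt (leq_trans im mk).
  by rewrite leqNgt; apply/negP => km; apply: dk; exact: abm.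
split=> [_ i _|_]; last by rewrite exprn_ge0 // ltW.
by apply: contrapT => di; apply: noi; exists i; exact/asboolP.
Qed.

Lemma Fhat_dist_cases a b :
  Fhat_dist a b = 0 \/ exists m, Fhat_dist a b = 2^-1 ^+ m.
Proof.
rewrite /Fhat_dist; case: pselect => [h|_]; last by left.
by right; exists (ex_minn h).
Qed.

Lemma Fhat_dist_ge0 a b : 0 <= Fhat_dist a b.
Proof.
have [->|[m ->]] := Fhat_dist_cases a b => //.
by rewrite exprn_ge0 // invr_ge0.
Qed.

Lemma Fhat_distxx a : Fhat_dist a a = 0.
Proof. by rewrite /Fhat_dist; case: pselect => // -[i di]; case: (asboolP _ di). Qed.

Lemma Fhat_dist_eq0 a b : Fhat_dist a b = 0 -> a = b.
Proof.
move=> d0; apply: val_inj; apply: funext => w; apply: propext.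
have [d wd] : exists d, val w \in kstage n d by exact: set_mem (valP w).
have ab : trunc a d = trunc b d.
  apply: (proj1 (Fhat_dist_le a b d.+1)) (ltnSn d).
  by rewrite d0 exprn_ge0 // invr_ge0.
have eqw c : val c w = trunc c d w.
  by apply: propext; split=> [cw|[]//]; split.
by rewrite !eqw ab.
Qed.

Lemma Fhat_dist_sym a b : Fhat_dist a b = Fhat_dist b a.
Proof.
have le c d : Fhat_dist c d <= Fhat_dist d c.
  have [d0|[m dm]] := Fhat_dist_cases d c.
    by rewrite (Fhat_dist_eq0 d0) Fhat_distxx.
  rewrite dm; apply/Fhat_dist_le => i im.
  by apply/esym; apply: (proj1 (Fhat_dist_le d c m)) im; rewrite dm.
by apply/eqP; rewrite eq_le !le.
Qed.

Lemma Fhat_dist_triangle b a c :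
  Fhat_dist a c <= Fhat_dist a b + Fhat_dist b c.
Proof.
have [d0|[m dm]] := Fhat_dist_cases a b.
  by rewrite (Fhat_dist_eq0 d0) Fhat_distxx add0r.
have [d0|[k dk]] := Fhat_dist_cases b c.
  by rewrite (Fhat_dist_eq0 d0) Fhat_distxx addr0.
have abm := proj1 (Fhat_dist_le a b m); rewrite dm in abm.
have bck := proj1 (Fhat_dist_le b c k); rewrite dk in bck.
apply: (@le_trans _ _ (2^-1 ^+ minn m k)).
  apply/Fhat_dist_le => i; rewrite leq_min => /andP[im ik].
  by rewrite abm // bck.
rewrite dm dk /minn; case: ifP => _.
  by rewrite lerDl exprn_ge0 // invr_ge0.
by rewrite lerDr exprn_ge0 // invr_ge0.
Qed.

HB.instance Definition _ := isMetric.Build Rdefinitions.R (Fhat n)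
  Fhat_distxx Fhat_dist_eq0 Fhat_dist_sym Fhat_dist_triangle.

(* The topology on [Fhat n] is the one of [Fhat_dist]. *)
Lemma dense_Fhat (H : set (Fhat n)) :
  dense H <->
  forall a (e : Rdefinitions.R), 0 < e -> exists2 h, H h & Fhat_dist a h < e.
Proof.
have ballE a (e : Rdefinitions.R) : ball a e = [set h | Fhat_dist a h < e].
  exact: (@ballEmdist _ (Fhat n)).
split=> [dH a e e0|dH U [a Ua] openU].
  have [h [/interior_subset ah Hh]] : (ball a e)^° `&` H !=set0.
    apply: dH; last exact: open_interior.
    by exists a; exact: (nbhsx_ballx a e e0).
  by exists h => //; move: ah; rewrite ballE.
have /nbhs_ballP[e /= e0 eU] : nbhs a U by exact: open_nbhs_nbhs.
have [h Hh ah] := dH a e e0.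
by exists h; split=> //; apply: eU; rewrite ballE.
Qed.

End Metric.

Lemma katom_subproof n (i : 'I_n) :
  kpt [set i]%SET fset0 \in [set w : nat | exists d, w \in kstage n d].
Proof.
apply/mem_set; exists 0%N; rewrite /kstage /= fset0U; apply/klayerP.
by exists [set i]%SET, fset0.
Qed.

Definition katom n (i : 'I_n) : K n :=
  exist _ (kpt [set i]%SET fset0) (katom_subproof i).

Lemma pregen_subproof n (i : 'I_n) : decreasing [set katom i].
Proof.
move=> v w vw /= wi; move: vw; rewrite wi /kle /kbelow kptK in_fset0 /=.
by move/eqP => eq_vw; apply: val_inj.
Qed.

Definition pregen n (i : 'I_n) : Fhat n := mkFhat (@pregen_subproof n i).

(* Main.v *)
Require Import Defs.
From mathcomp Require Import all_boot all_classical topology_structure.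
From mathcomp Require Import all_order all_algebra finmap Rstruct.

(** By density [H] contains every finite decreasing set: if [a] lies in
    K_n^(d-1) and [h] agrees with [a] on K_n^d, then [h] has no point of depth
    exactly [d], hence none of greater depth either.  An element [x] of [H] is
    therefore of the form {v | v <= w} for some point [w] iff there is a
    greatest element of [H] strictly below [x], namely {v | v < w}; so
    (K_n, <=) is definable in [H] without parameters.

    The value of [w] is recovered by counting points.  If a_i is not below [w],
    the points whose set of strict predecessors is w! U a_i, where
    w! = {v | v <= w}, are the w_(b, w! U a_i) with [b] contained in the
    intersection of val(w) and {P_i}: there are two of them if P_i is in val(w)
    and one otherwise.  If a_i is below [w], then val(w) is contained in {P_i},
    and w_(b, w!) is a point iff [b] is a proper subset of val(w), so that P_i
    is in val(w) iff such a point exists. *)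

Set Implicit Arguments.
Unset Strict Implicit.
Unset Printing Implicit Defensive.

Import Order.TTheory GRing.Theory Num.Theory.
Local Open Scope classical_set_scope.

(** * Order and values on the coded points of K_n, and their depth *)

Lemma kpt_decode n d w : w \in kprev n d -> w = kpt (kval n w) (kbelow n w).
Proof.
elim: d => [|d IHd] /=; first by rewrite in_fset0.
rewrite in_fsetU => /orP[/IHd //|/klayerP[b [Y [_ _ ->]]]].
by rewrite /kval /kbelow kptK.
Qed.

Lemma kprev_mono n d e : (d <= e)%N -> (kprev n d `<=` kprev n e)%fset.
Proof.
move=> /subnK <-; elim: (e - d)%N => [|k IHk] //=.
exact: fsubset_trans IHk (fsubsetUl _ _).
Qed.

(* [d] is the depth of [w], the least stage at which [w] appears. *)
Lemma kdepth n e w : w \in kprev n e ->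
  exists d, [/\ (d < e)%N, w \notin kprev n d, w \in kprev n d.+1,
    kadmissible (kprev n d) (kval n w) (kbelow n w) &
    forall d', d = d'.+1 -> ~~ (kbelow n w `<=` kprev n d')%fset].
Proof.
elim: e => [|e IHe]; first by rewrite in_fset0.
case: (boolP (w \in kprev n e)) => [/IHe[d [de h1 h2 h3 h4]] _|we we1].
  by exists d; split=> //; exact: ltn_trans de _.
exists e; split=> //; move: we1; rewrite /= in_fsetU (negbTE we) /= =>
  /klayerP[b [Y [PY bY wE]]]; rewrite /kval /kbelow wE kptK //=.
by move=> d' ed'; move: PY; rewrite ed'.
Qed.

Lemma kbelow_sub n d v w :
  w \in kprev n d.+1 -> v \in kbelow n w -> v \in kprev n d.
Proof.
move=> /kdepth[e [ed _ _ [/fsubsetP sY _ _ _] _]] /sY; move: v.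
by apply/fsubsetP/kprev_mono.
Qed.

Lemma kle_prev n d v w : w \in kprev n d -> kle n v w -> v \in kprev n d.
Proof.
case: d => [|d]; first by rewrite in_fset0.
move=> wd /orP[vw|/eqP -> //]; move: (kbelow_sub wd vw).
by apply: fsubsetP; exact: kprev_mono.
Qed.

Lemma kle_refl n w : kle n w w.
Proof. by rewrite /kle eqxx orbT. Qed.

(** The predecessor set of [w] is decreasing within the stage preceding [w]; since stages are
    downward closed, [u] lies in that stage as well. *)
Lemma kle_below n d u v w : w \in kprev n d ->
  kle n u v -> v \in kbelow n w -> u \in kbelow n w.
Proof.
move=> /kdepth[e [_ _ _ [/fsubsetP sY dY _ _] _]] uv vw.
by apply: dY (uv) => //; exact: kle_prev (sY _ vw) uv.
Qed.

Lemma kle_trans n d u v w : w \in kprev n d ->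
  kle n u v -> kle n v w -> kle n u w.
Proof.
move=> wd uv /orP[vw|/eqP <- //].
by rewrite /kle (kle_below wd uv vw).
Qed.

Lemma kbelow_irr n d w : w \in kprev n d -> w \notin kbelow n w.
Proof.
move=> /kdepth[e [_ we _ [/fsubsetP sY _ _ _] _]].
by apply: contra we => /sY.
Qed.

Lemma kle_anti n d v w : w \in kprev n d -> kle n v w -> kle n w v -> v = w.
Proof.
move=> wd /orP[vw|/eqP //] wv.
by move: (kbelow_irr wd); rewrite (kle_below wd wv vw).
Qed.

Lemma kval_below n d v w : w \in kprev n d -> v \in kbelow n w ->
  kval n w \subset kval n v.
Proof. by move=> /kdepth[e [_ _ _ [_ _ h _] _]] /h. Qed.

Lemma kval_principal n d v w : w \in kprev n d ->
  (forall u, (u \in kbelow n w) = kle n u v) -> kval n w <> kval n v.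
Proof.
move=> /kdepth[e [_ _ _ [/fsubsetP sY _ _ h] _]] wv.
have ve : v \in kprev n e by apply: sY; rewrite wv kle_refl.
apply: h => //; apply/fsetP => u; rewrite !inE /= wv.
by apply/idP/andP => [uv|[]//]; split=> //; exact: kle_prev uv.
Qed.

(** The hypotheses are the conditions on (b, Y) freed of any stage. Choosing the least stage that
    contains [Y] ensures that [Y] is not inside the previous one; the principality condition
    transfers because stages are downward closed. *)
Lemma kpt_exists n d (b : {set 'I_n}) (Y : {fset nat}) :
  (Y `<=` kprev n d)%fset ->
  (forall v w, w \in Y -> kle n v w -> v \in Y) ->
  (forall w, w \in Y -> b \subset kval n w) ->
  (forall w, (forall u, (u \in Y) = kle n u w) -> b <> kval n w) ->
  exists e, kpt b Y \in kprev n e.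
Proof.
move=> Yd dY bY pY; have exd : exists d, (Y `<=` kprev n d)%fset by exists d.
case: (ex_minnP exd) => e Ye emin; exists e.+1.
rewrite /= in_fsetU; apply/orP; right; apply/klayerP; exists b, Y; split=> //.
  by case: e emin {Ye} => // e emin; apply/negP => /emin; rewrite ltnn.
split=> // [v w wY _|w we YE]; first exact: dY.
apply: pY => u; rewrite YE !inE /=.
by apply/andP/idP => [[]//|uw]; split=> //; exact: kle_prev uw.
Qed.

(** Strong induction on the stage: a point of positive depth has a strict predecessor exactly one
    level lower, so one descends level by level until depth [d]. *)
Lemma kle_depth n d e w : w \in kprev n e -> w \notin kprev n d ->
  exists v, [/\ kle n v w, v \notin kprev n d & v \in kprev n d.+1].
Proof.
elim/ltn_ind: e w => e IHe w /kdepth[c [ce wc wc1 _ h]] wd.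
have dc : (d <= c)%N.
  rewrite leqNgt; apply: contra wd => cd.
  exact: (fsubsetP (kprev_mono _ cd)).
case: (ltngtP d c) dc => // [dc _|dE _]; last first.
  by exists w; rewrite kle_refl wd dE.
case: c => // c in ce wc wc1 h dc *.
have /fsubsetPn[v vw vc] := h c erefl.
have [||u [uv ud ud1]] := IHe c.+1 ce v.
- exact: kbelow_sub wc1 vw.
- by apply: contra vc; apply: fsubsetP; exact: kprev_mono.
by exists u; split=> //; rewrite /kle (kle_below wc1 uv vw).
Qed.

(** * Decreasing sets generated by a point *)

Section Downsets.
Variable n : nat.
Implicit Types (a x y : Fhat n) (u v w : K n).

Lemma K_stage w : exists d, val w \in kprev n d.
Proof. by have [d wd] := set_mem (valP w); exists d.+1. Qed.

Lemma K_lift d m : m \in kprev n d -> exists w, val w = m.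
Proof.
move=> md; have h : m \in [set w : nat | exists d, w \in kstage n d].
  by apply/mem_set; exists d; move: md; apply: fsubsetP; exact: kprev_mono.
by exists (exist _ m h).
Qed.

Lemma Fhat_eqP x y : (forall w, val x w <-> val y w) -> x = y.
Proof. by move=> xy; apply: val_inj; apply: funext => w; apply: propext. Qed.

Lemma Fhat_mem x y : x = y -> forall w, val x w <-> val y w.
Proof. by move->. Qed.

Lemma dn_subproof w : decreasing [set v : K n | kle n (val v) (val w)].
Proof.
by have [d wd] := K_stage w; move=> u v uv /= vw; exact: kle_trans wd uv vw.
Qed.
Definition dn w : Fhat n := mkFhat (@dn_subproof w).

Lemma sdn_subproof w : decreasing [set v : K n | val v \in kbelow n (val w)].
Proof.
by have [d wd] := K_stage w; move=> u v uv /= vw; exact: kle_below wd uv vw.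
Qed.
Definition sdn w : Fhat n := mkFhat (@sdn_subproof w).

Lemma dn_inj : injective dn.
Proof.
move=> v w vw; have [d wd] := K_stage w.
have h u : kle n (val u) (val v) = kle n (val u) (val w).
  by have /= uP := Fhat_mem vw u; apply/idP/idP => /uP.
apply: val_inj; apply: (kle_anti wd); first by rewrite -h kle_refl.
by rewrite h kle_refl.
Qed.

Lemma kbelow_K v m : m \in kbelow n (val v) -> exists u, val u = m.
Proof.
have [d vd] := K_stage v => mv; apply: (@K_lift d).
by apply: kle_prev vd _; rewrite /kle mv.
Qed.

(** Every code in a predecessor set is itself a point of K_n, so no code is lost in passing to
    subsets of [K n]. *)
Lemma sdn_kbelow v w : sdn v = sdn w -> kbelow n (val v) = kbelow n (val w).
Proof.
move=> vw.
have h u : (val u \in kbelow n (val v)) = (val u \in kbelow n (val w)).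
  by have /= uP := Fhat_mem vw u; apply/idP/idP => /uP.
by apply/fsetP => m; apply/idP/idP => /[dup] /kbelow_K[u <-]; rewrite h.
Qed.

Lemma K_eq v w : kval n (val v) = kval n (val w) -> sdn v = sdn w -> v = w.
Proof.
move=> vw /sdn_kbelow yy; apply: val_inj.
have [[d vd] [e we]] := (K_stage v, K_stage w).
by rewrite (kpt_decode vd) (kpt_decode we) vw yy.
Qed.

Lemma kval_dn v w :
  kle n (val v) (val w) -> kval n (val w) \subset kval n (val v).
Proof.
have [d wd] := K_stage w; move=> /orP[/(kval_below wd) //|/eqP ->].
exact: subxx.
Qed.

(** * Values read off from the points with prescribed predecessors *)

Lemma K_exists d (b : {set 'I_n}) (Y : {fset nat}) : (Y `<=` kprev n d)%fset ->
  (forall k m, m \in Y -> kle n k m -> k \in Y) ->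
  (forall m, m \in Y -> b \subset kval n m) ->
  (forall m, (forall k, (k \in Y) = kle n k m) -> b <> kval n m) ->
  exists v, kval n (val v) = b /\ kbelow n (val v) = Y.
Proof.
move=> h1 h2 h3 h4; have [e /K_lift[v vE]] := kpt_exists h1 h2 h3 h4.
by exists v; rewrite vE /kval /kbelow kptK.
Qed.

Lemma katom_le i v : kle n (val v) (val (katom i)) -> v = katom i.
Proof.
by rewrite /kle /kbelow kptK in_fset0 /= => /eqP h; exact: val_inj.
Qed.

Lemma pregen_le i w :
  val (pregen i) `<=` val (dn w) <-> kle n (val (katom i)) (val w).
Proof. by split=> [h|h _ /= ->//]; exact: (h (katom i)). Qed.

(** The witness is w_(b, w!) with [b] empty. Conversely the value of [v] is a proper subset of that
    of [w], which is therefore nonempty and, being contained in {P_i}, equal to it. *)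
Lemma mem_kval_above i w : kle n (val (katom i)) (val w) ->
  i \in kval n (val w) <-> exists v, sdn v = dn w.
Proof.
move=> iw; have [d wd] := K_stage w; split.
  move=> ivw; have [||||v [_ vY]] :=
      @K_exists d finset.set0 (val w |` kbelow n (val w))%fset.
  - apply/fsubsetP => u; rewrite in_fset1U orbC; exact: kle_prev wd.
  - move=> u v; rewrite !in_fset1U ![_ || (_ \in _)]orbC => vw uv.
    exact: kle_trans wd uv vw.
  - by move=> *; exact: finset.sub0set.
  (* If [v] also generates w!, then v = w by antisymmetry, and the value of [w] contains [i], so it
     is not empty. *)
  - move=> v vE; have wv : kle n (val w) v by rewrite -vE in_fset1U eqxx.
    have vw : kle n v (val w).
      by rewrite /kle orbC -in_fset1U vE kle_refl.
    rewrite (kle_anti wd vw wv) => v0; move: ivw.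
    by rewrite -v0 finset.in_set0.
  by exists v; apply: Fhat_eqP => u /=; rewrite vY in_fset1U orbC.
move=> [v vw]; have [e ve] := K_stage v.
have yE m : (m \in kbelow n (val v)) = kle n m (val w).
  apply/idP/idP.
    by move=> /[dup] /kbelow_K[u <-] /(Fhat_mem vw u).
  move=> mw; have [u uE] := K_lift (kle_prev wd mw).
  by rewrite -uE in mw *; exact/(Fhat_mem vw u).
have := kval_principal ve yE.
have sw : kval n (val w) \subset [set i]%SET.
  by have := kval_dn iw; rewrite {2}/kval kptK.
have sv : kval n (val v) \subset kval n (val w).
  by apply: (kval_below ve); rewrite yE kle_refl.
move=> vnw; apply: contrapT => /negP iw0; apply: vnw.
have w0 : kval n (val w) = finset.set0.
  apply/eqP; rewrite -finset.subset0; apply/fintype.subsetP => j jw.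
  move: (fintype.subsetP sw _ jw) (jw); rewrite finset.in_set1 => /eqP ->.
  by rewrite (negbTE iw0).
by apply/eqP; rewrite w0 in sv *; rewrite -finset.subset0.
Qed.

Lemma mem_kval_aside i w : ~ kle n (val (katom i)) (val w) ->
  i \in kval n (val w) <->
  exists v v', [/\ v <> v', sdn v = Fhat_join (dn w) (pregen i) &
    sdn v' = Fhat_join (dn w) (pregen i)].
Proof.
move=> iw; have [d wd] := K_stage w; split.
  move=> ivw.
  (* To be applied to [b] empty and to b = {P_i}, which gives two points with the same predecessors
     and different values. *)
  have ex (b : {set 'I_n}) : b \subset [set i]%SET ->
      exists v, kval n (val v) = b /\ sdn v = Fhat_join (dn w) (pregen i).
    move=> bi; set ai := val (katom i).
    have [e0 ad] := K_stage (katom i).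
    pose Y := (ai |` (val w |` kbelow n (val w)))%fset.
    have YE m : (m \in Y) = (m == ai) || kle n m (val w).
      by rewrite /Y !in_fset1U /kle [(m == val w) || _]orbC.
    have [||||v [vb vY]] := @K_exists (maxn d e0) b Y.
    - apply/fsubsetP => u; rewrite YE => /orP[/eqP ->|uw].
        by apply: (fsubsetP (kprev_mono _ (leq_maxr _ _))).
      apply: (fsubsetP (kprev_mono _ (leq_maxl _ _))); exact: kle_prev uw.
    - move=> u v; rewrite !YE => /orP[/eqP ->|vw] uv.
        by move: uv; rewrite {1}/kle /kbelow kptK in_fset0 /= => ->.
      by rewrite (kle_trans wd uv vw) orbT.
    - move=> u; rewrite YE => /orP[/eqP ->|uw].
        by rewrite /kval kptK.
      have [u' u'E] := K_lift (kle_prev wd uw).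
      apply: (fintype.subset_trans bi); rewrite -u'E in uw *.
      apply: fintype.subset_trans (kval_dn uw).
      by rewrite finset.sub1set.
    (* The set is not principal: a generator equal to the atom would force [w] to be the atom, and a
       generator below [w] would put the atom below [w]. *)
    - move=> u uE _; have := kle_refl n u; rewrite -uE YE => /orP[/eqP ua|uw].
        have : kle n (val w) ai by rewrite -ua -uE YE kle_refl orbT.
        by move=> /katom_le wE; apply: iw; rewrite wE kle_refl.
      by apply: iw; apply: (kle_trans wd) uw; rewrite -uE YE eqxx.
    exists v; split=> //; apply: Fhat_eqP => u /=; rewrite vY YE; split.
      by case/orP => [/eqP /val_inj ->|]; [right|left].
    by case=> [->|->]; rewrite ?eqxx ?orbT.
  have [v [v0 vE]] := ex _ (finset.sub0set _).
  have [v' [v'i v'E]] := ex _ (fintype.subxx _).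
  exists v, v'; split=> // vv'; move: v0; rewrite vv' v'i.
  move=> /(congr1 (fun A : {set 'I_n} => i \in A)).
  by rewrite finset.in_set1 finset.in_set0 eqxx.
move=> [v [v' [vv' vE v'E]]]; apply: contrapT => /negP iw0; apply: vv'.
apply: K_eq; last by rewrite vE.
(* Any such point has its value inside both {P_i} and val(w), hence empty; by [K_eq] there is at
   most one. *)
have val0 u :
    sdn u = Fhat_join (dn w) (pregen i) -> kval n (val u) = finset.set0.
  move=> uE; have [e ue] := K_stage u.
  have h (x : K n) : val (Fhat_join (dn w) (pregen i)) x ->
      kval n (val u) \subset kval n (val x).
    by rewrite -uE; exact: kval_below ue.
  have ui : kval n (val u) \subset [set i]%SET.
    have := h (katom i); rewrite [kval n (val (katom i))]/kval kptK.
    by apply; right.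
  have uw : kval n (val u) \subset kval n (val w).
    by apply: h; left; exact: kle_refl.
  apply/eqP; rewrite -finset.subset0; apply/fintype.subsetP => j ju.
  move: (fintype.subsetP ui _ ju) (fintype.subsetP uw _ ju).
  by rewrite finset.in_set1 => /eqP ->; rewrite (negbTE iw0).
by rewrite !val0.
Qed.

(** * Finite decreasing sets in a dense subset, and points recognised by covers *)

Definition cover (H : set (Fhat n)) y x : Prop :=
  [/\ val y `<=` val x, y <> x &
      forall z, H z -> val z `<=` val x -> z <> x -> val z `<=` val y].

Section Dense.
Variable (H : set (Fhat n)).
Hypothesis H_dense : dense H.

Lemma dense_bounded a d : (forall w, val a w -> val w \in kprev n d) -> H a.
Proof.
(* Distance below 2^-(d+1) forces agreement at index [d], that is on [kprev n d.+1], one level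
   beyond the bound on [a]. *)
move=> ad; have [|h Hh ah] := (dense_Fhat H).1 H_dense a (2^-1 ^+ d.+1)%R.
  by rewrite exprn_gt0 // invr_gt0 ltr0n.
suff -> : a = h by [].
have := (Fhat_dist_le a h d.+1).1 (ltW ah) d (ltnSn d) => tE.
have trE c w : val w \in kprev n d.+1 -> trunc c d w <-> val c w.
  by move=> wd; split=> [[]//|cw]; split.
have aE w : val w \in kprev n d.+1 -> val a w <-> val h w.
  by move=> wd; rewrite -(trE a) // tE trE.
have dd m : m \in kprev n d -> m \in kprev n d.+1.
  by apply: fsubsetP; exact: kprev_mono.
apply: Fhat_eqP => w; split=> [aw|hw]; first by apply/aE => //; exact/dd/ad.
apply: contrapT => naw.
case: (boolP (val w \in kprev n d)) => [/dd/aE[_ /(_ hw)] //|wd].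
have [e we] := K_stage w.
(* A point of [h] outside the bound lies above one of depth exactly [d]; there [h] agrees with [a],
   which has no such point. *)
have [m [mw md md1]] := kle_depth we wd.
have [u uE] := K_lift md1; rewrite -uE in mw md md1.
have /(aE _ md1)/ad : val h u by exact: FhatP mw hw.
by rewrite (negbTE md).
Qed.

Lemma dense_dn w : H (dn w).
Proof.
have [d wd] := K_stage w; apply: (@dense_bounded _ d) => v /=.
exact: kle_prev.
Qed.

Lemma dense_sdn w : H (sdn w).
Proof.
have [d wd] := K_stage w; apply: (@dense_bounded _ d) => v /= vw.
by apply: kle_prev wd _; rewrite /kle vw.
Qed.

Lemma dense_pregen i : H (pregen i).
Proof.
by have [d wd] := K_stage (katom i); apply: (@dense_bounded _ d) => v /= ->.
Qed.

Lemma dn_le x w : val x w -> val (dn w) `<=` val x.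
Proof. by move=> xw v /= vw; exact: FhatP vw xw. Qed.

(** If [x] is not principal, every [dn w] with [w] in [x] is an element of [H] strictly below [x],
    hence below [y]; their union is [x], so y = x, a contradiction. *)
Lemma coverP y x : cover H y x <-> exists w, x = dn w /\ y = sdn w.
Proof.
split=> [[yx ynx ymax]|[w [-> ->]]].
  have [w xE] : exists w, x = dn w.
    apply: contrapT => nx; apply: ynx.
    apply: Fhat_eqP => w; split; first exact: yx.
    move=> xw; apply: (ymax (dn w)); last exact: kle_refl.
    - exact: dense_dn.
    - exact: dn_le.
    - by move=> wx; apply: nx; exists w.
  exists w; split=> //; have [d wd] := K_stage w.
  have sx : sdn w <> x.
    rewrite xE => sE; have : val (dn w) w by exact: kle_refl.
    by rewrite -sE /=; apply/negP; exact: kbelow_irr wd.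
  apply: Fhat_eqP => u; split=> [yu|]; last first.
    apply: (ymax (sdn w)) => //; first exact: dense_sdn.
    by rewrite xE => v /= vw; rewrite /kle vw.
  (* If [w] itself were in [y], then [y] would be all of [x]. *)
  have := yx _ yu; rewrite xE /= => /orP[//|/eqP/val_inj uw].
  case: ynx; apply: Fhat_eqP => v; split; first exact: yx.
  by rewrite xE => vw; apply: (dn_le (w := w)) vw; rewrite -uw.
have [d wd] := K_stage w; split.
- by move=> v /= vw; rewrite /kle vw.
- move=> sE; have : val (dn w) w by exact: kle_refl.
  by rewrite -sE /=; apply/negP; exact: kbelow_irr wd.
- move=> z _ zw znw v zv; have := zw _ zv => /orP[//|/eqP/val_inj vw].
  case: znw; apply: Fhat_eqP => u; split; first exact: zw.
  by move=> uw; apply: (dn_le (w := w)) uw; rewrite -vw.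
Qed.

End Dense.
End Downsets.

(** * The defining formulas in the language of Heyting algebras *)

Section Formulas.
Variable X : Type.
Implicit Types s t : term ha_sig X.

Definition pair2 (T : Type) (s t : T) (i : 'I_2) : T :=
  if i == ord0 then s else t.

Definition TJoin s t : term ha_sig X := @App ha_sig X Join (pair2 s t).
Definition FLe s t : formula ha_sig X :=
  FEq (@App ha_sig X Meet (pair2 s t)) s.
Definition FNot (phi : formula ha_sig X) := FImp phi (FFalse _ _).
Definition FTrue : formula ha_sig X := FNot (FFalse _ _).

End Formulas.

Definition FCover (X : Type) (y x : X) : formula ha_sig X :=
  FAnd (FLe (Var _ y) (Var _ x)) (FAnd (FNot (FEq (Var _ y) (Var _ x)))
    (FAll (FImp (FLe (Var _ None) (Var _ (Some x)))
      (FImp (FNot (FEq (Var _ None) (Var _ (Some x))))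
        (FLe (Var _ None) (Var _ (Some y))))))).

Definition FPoint (X : Type) (x : X) : formula ha_sig X :=
  FEx (FCover None (Some x)).

(** The disjuncts separate the cases of [a] below [x] or not. In the second, the outer two bound
    variables are the distinct points and the innermost, [None], is their common set of strict
    predecessors. *)
Definition FMemVal (X : Type) (a x : X) : formula ha_sig X :=
  FOr (FAnd (FLe (Var _ a) (Var _ x)) (FEx (FCover (Some x) None)))
      (FAnd (FNot (FLe (Var _ a) (Var _ x)))
        (FEx (FEx (FEx
          (FAnd (FEq (Var _ None)
                     (TJoin (Var _ (Some (Some (Some x))))
                            (Var _ (Some (Some (Some a))))))
          (FAnd (FNot (FEq (Var _ (Some None)) (Var _ (Some (Some None)))))
          (FAnd (FCover None (Some None))
                (FCover None (Some (Some None)))))))))).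

Definition FVal n (X : Type) (a : 'I_n -> X) (J : {set 'I_n}) (x : X) :
  formula ha_sig X :=
  foldr (fun i => FAnd
      (if i \in J then FMemVal (a i) x else FNot (FMemVal (a i) x)))
    (FTrue X) (enum 'I_n).

(** * Semantics of the formulas in [H] and the interpretation *)

Section Interpretation.
Variables (n : nat) (H : set (Fhat n)) (H_sub : heyting_subalgebra H).
Hypothesis H_dense : dense H.
Local Notation N := (substructure H_sub).

Lemma N_mem (h : N) : H (val h).
Proof. exact: set_mem (valP h). Qed.

Definition toN (a : Fhat n) (Ha : H a) : N := exist _ a (mem_set Ha).

Lemma sat_FLe X (v : X -> N) s t :
  sat (FLe s t) v <-> val (val (eval v s)) `<=` val (val (eval v t)).
Proof.
split=> [/(congr1 val)/Fhat_mem st w /st [] //|st].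
by apply/val_inj/Fhat_eqP => w; split=> [[] //|sw]; split=> //; exact: st.
Qed.

Lemma sat_FCover X (v : X -> N) y x :
  sat (FCover y x) v <-> cover H (val (v y)) (val (v x)).
Proof.
split=> [[/sat_FLe yx [ynx h]]|[yx ynx h]].
  split=> [||z Hz zx znx]; [exact: yx|by move=> /val_inj|].
  have zx' := (sat_FLe (extend v (toN Hz)) (Var _ None) (Var _ (Some x))).2 zx.
  by have /sat_FLe := h _ zx' (fun e => znx (congr1 val e)).
split; first exact/sat_FLe; split; first by move=> yE; apply: ynx; congr val.
move=> z /sat_FLe zx znx; apply/sat_FLe; apply: h zx _ => //.
  exact: N_mem.
by move=> /val_inj.
Qed.

Lemma sat_FPoint X (v : X -> N) x :
  sat (FPoint x) v <-> exists w, val (v x) = dn w.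
Proof.
split=> [[y /sat_FCover/(coverP H_dense)[w [xE _]]]|[w xE]]; first by exists w.
exists (toN (dense_sdn H_dense w)); apply/sat_FCover/(coverP H_dense).
by exists w.
Qed.

Lemma sat_FMemVal X (v : X -> N) i w a x :
  val (v a) = pregen i -> val (v x) = dn w ->
  sat (FMemVal a x) v <-> i \in kval n (val w).
Proof.
move=> aE xE.
have leE : sat (FLe (Var _ a) (Var _ x)) v <-> kle n (val (katom i)) (val w).
  by apply: (iff_trans (sat_FLe _ _ _)); rewrite /= aE xE; exact: pregen_le.
split.
  case=> [[/leE iw [y /sat_FCover/(coverP H_dense)[u [_ uE]]]]|].
    by apply/(mem_kval_above iw); exists u; rewrite -uE /= xE.
  move=> [niw [y1 [y2 [z /= [zE [y12]]]]]].
  move=> [/sat_FCover/(coverP H_dense)/= [u2 [uE2 z2]]].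
  move=> /sat_FCover/(coverP H_dense)/= [u1 [uE1 z1]].
  have {}zE : val z = Fhat_join (dn w) (pregen i) by rewrite zE /= aE xE.
  apply/mem_kval_aside; first by move/leE.
  exists u1, u2; rewrite -z1 -z2 zE; split=> // uu; apply: y12.
  apply: val_inj.
  exact: (etrans uE2 (etrans (congr1 _ (esym uu)) (esym uE1))).
move=> ivw; have [iw|niw] := pselect (sat (FLe (Var _ a) (Var _ x)) v).
  left; split=> //; move/leE/mem_kval_above/proj1/(_ ivw): iw => [u uE].
  exists (toN (dense_dn H_dense u)); apply/sat_FCover/(coverP H_dense).
  by exists u; rewrite /= xE uE.
right; split=> //.
have /mem_kval_aside/proj1/(_ ivw)[u1 [u2 [u12 uE1 uE2]]] :
  ~ kle n (val (katom i)) (val w) by move/leE.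
(* All three witnesses lie in [H] by density, as they are finite decreasing sets. *)
exists (toN (dense_dn H_dense u1)), (toN (dense_dn H_dense u2)).
exists (toN (dense_sdn H_dense u1)); split.
  by apply: val_inj; rewrite /= aE xE.
split; first by move=> /(congr1 val)/dn_inj/esym.
split; apply/sat_FCover/(coverP H_dense); last by exists u1.
by exists u2; rewrite /= uE1 uE2.
Qed.

Lemma sat_FVal X (v : X -> N) (a : 'I_n -> X) J w x :
  (forall i, val (v (a i)) = pregen i) -> val (v x) = dn w ->
  sat (FVal a J x) v <-> kval n (val w) = J.
Proof.
move=> aE xE; have iP i := sat_FMemVal (aE i) xE.
have satE s : sat (foldr (fun i => FAnd
      (if i \in J then FMemVal (a i) x else FNot (FMemVal (a i) x)))
    (FTrue X) s) v <-> {in s, forall i, (i \in kval n (val w)) = (i \in J)}.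
  elim: s => [|i s IHs] //=; split.
    move=> [h /IHs hs] j; rewrite in_cons => /orP[/eqP ->|]; last exact: hs.
    case: (i \in J) h => [/iP -> //|h]; by apply/negbTE/negP => /iP.
  move=> h; split; last by apply/IHs => j js; apply: h; rewrite in_cons js orbT.
  have := h i (mem_head _ _); case: (i \in J) => [/iP //|/negbT ni].
  by move=> /iP; apply/negP.
apply: (iff_trans (satE _)); split=> [h|-> //].
by apply/finset.setP => i; apply: h; rewrite mem_enum.
Qed.

Definition pregenN (i : 'I_n) : N := toN (dense_pregen H_dense i).

Definition Npoint : formula ha_sig (unit * 'I_1 + 'I_n) :=
  FPoint (inl (tt, ord0)).

Lemma Npoint_exists (t : tuples_sat pregenN Npoint) :
  exists w, val (sval t ord0) = dn w.
Proof. by case: t => t /= /sat_FPoint. Qed.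

(** The choice is harmless, since [dn_inj] makes the point unique. *)
Definition point_of (t : tuples_sat pregenN Npoint) : K n :=
  sval (cid (Npoint_exists t)).

Lemma point_ofE t : val (sval t ord0) = dn (point_of t).
Proof. exact: svalP (cid (Npoint_exists t)). Qed.

(** The interpretation has dimension 1 and represents [w] by w!: equality is then equality in [H],
    and the order is inclusion. The parameters enter only through the formulas for the values. *)
Lemma interpretable_kripke_model : interpretable (kripke_model n) pregenN.
Proof.
split; unshelve refine (@Interpretation (kripke_sig n) ha_sig (kripke_model n)
  N 'I_n pregenN 1 isT Npoint
  (FEq (Var _ (inl (ord0, ord0))) (Var _ (inl (ord_max, ord0))))
  (fun r => match r return formula ha_sig ('I_(kripke_ar r) * 'I_1 + 'I_n) with
     | KLe => FLe (Var _ (inl (ord0, ord0))) (Var _ (inl (ord_max, ord0)))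
     | KVal J => FVal inr J (inl (ord0, ord0))
     end)
  (fun f : void => match f with end) point_of _ _ _ _).
- move=> w.
  pose t (_ : 'I_1) := toN (dense_dn H_dense w).
  have h : sat Npoint (valuation (fun=> t) pregenN).
    by apply/sat_FPoint; exists w.
  exists (exist _ t h); apply: dn_inj.
  by rewrite -point_ofE.
- move=> t /=; split=> [|tE].
    by move=> /(congr1 val); rewrite !point_ofE => /dn_inj.
  by apply: val_inj; rewrite !point_ofE tE.
- case=> [|J] t.
    apply: (iff_trans (sat_FLe _ _ _)); rewrite /= !point_ofE.
    by split=> [|tt']; [apply; exact: kle_refl|exact: dn_le].
  by apply: sat_FVal => //; exact: point_ofE.
- by case.
Qed.

End Interpretation.

Theorem corollary6p2 (n : nat) (n_ge1 : (1 <= n)%N)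
  (H : set (Fhat n)) (H_sub : heyting_subalgebra H) (H_dense : dense H) :
  exists a : 'I_n -> substructure H_sub,
    (forall i : 'I_n, val (a i) = pregen i) /\
    interpretable (kripke_model n) a.
Proof.
exists (pregenN H_sub H_dense); split=> //.
exact: interpretable_kripke_model.
Qed.
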